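(* Let $s>0$ and $x=1+1/s$; all polynomials below are evaluated at $x$. (1) If $m\ge3$ is an odd natural number, then $$\|A_m\|_\infty=\frac{1}{U_m}\left(\Big|P_m+\sum_{n=1}^{\frac{m-1}{2}}C_{2n-1}\Big|+2\sum_{i=0}^{\frac{m-3}{2}}\ \sum_{n=1}^{\frac{m-(2i+1)}{2}}C_{2n+i}\right).$$ (2) If $m\ge2$ is an even natural number, then $$\|A_m\|_\infty=\frac{1}{U_m}\left(\Big|P_m+\sum_{n=1}^{\frac m2-1}C_{2n}\Big|+\sum_{i=1}^{\frac m2-1}\ \sum_{n=1+i}^{m-i}C_n+\sum_{n=1}^{m/2}C_{2n-1}\right).$$
   Context: For $m\ge1$ and $s>0$, the Crank-Nicolson iteration matrix is the $m\times m$ matrix $A_m=M_m(s)^{-1}N_m(s)$, where $M_m(s)$ is the $m\times m$ tridiagonal matrix with diagonal entries $1+s$ and sub- and super-diagonal entries $-s/2$, and $N_m(s)$ is the $m\times m$ tridiagonal matrix with diagonal entries $1-s$ and sub- and super-diagonal entries $s/2$. The norm is $\|A\|_\infty=\max_i\sum_j|a_{ij}|$. The polynomials are defined, for $n\ge2$, by the common recurrence $Q_n(x)=2xQ_{n-1}(x)-Q_{n-2}(x)$ with different initial values: $U_0=1,\ U_1=2x$ (Chebyshev polynomials of the second kind); $P_0=-1,\ P_1=2x-4$; $C_0=0,\ C_1=4(x-1)$. Empty sums are zero. *)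

(* Defs.v *)
From HB Require Import structures.
From mathcomp Require Import all_boot all_order all_algebra.

Set Implicit Arguments.
Unset Strict Implicit.
Unset Printing Implicit Defensive.

Import Order.TTheory GRing.Theory Num.Theory.
Local Open Scope ring_scope.

Definition tridiag_mx (R : pzRingType) (m : nat) (a b : R) : 'M[R]_m :=
  \matrix_(i < m, j < m)
    if i == j then a
    else if (i.+1 == j :> nat) || (j.+1 == i :> nat) then b else 0.

Definition CN_M (R : realFieldType) (m : nat) (s : R) : 'M[R]_m :=
  tridiag_mx m (1 + s) (- (s / 2)).

Definition CN_N (R : realFieldType) (m : nat) (s : R) : 'M[R]_m :=
  tridiag_mx m (1 - s) (s / 2).

(* For s > 0, CN_M m s is strictly diagonally dominant, hence invertible, so
   invmx (which returns a singular argument unchanged) is a genuine inverse. *)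
Definition CN_A (R : realFieldType) (m : nat) (s : R) : 'M[R]_m :=
  invmx (CN_M m s) *m CN_N m s.

(* The default value 0 of the maximum is harmless: row sums are nonnegative. *)
Definition norm_infty (R : realFieldType) (m : nat) (A : 'M[R]_m) : R :=
  \big[Num.max/0]_(i < m) \sum_(j < m) `|A i j|.

Fixpoint cheb_rec (R : comNzRingType) (Q0 Q1 : {poly R}) (n : nat) : {poly R} :=
  match n with
  | 0 => Q0
  | n'.+1 =>
    match n' with
    | 0 => Q1
    | n''.+1 => 2 *: 'X * cheb_rec Q0 Q1 n' - cheb_rec Q0 Q1 n''
    end
  end.

Definition chebU (R : comNzRingType) (n : nat) : {poly R} :=
  cheb_rec 1 (2 *: 'X) n.

Definition chebP (R : comNzRingType) (n : nat) : {poly R} :=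
  cheb_rec (- 1) (2 *: 'X - 4%:P) n.

Definition chebC (R : comNzRingType) (n : nat) : {poly R} :=
  cheb_rec 0 (4 *: ('X - 1)) n.

(* Main.v *)
Require Import Defs.
From HB Require Import structures.
From mathcomp Require Import all_boot all_order all_algebra.
From mathcomp Require Import zify ring lra.

Import Order.TTheory GRing.Theory Num.Theory.
Local Open Scope ring_scope.

(** With x = 1 + 1/s the two tridiagonal matrices satisfy N = 2 - M and
    M = (s/2) T, where T is the tridiagonal matrix with diagonal 2x and
    off-diagonal -1; hence A = 2 M^-1 - 1.  The inverse of T is the discrete
    Green function: its (i, j) entry is a product of two solutions of the
    Chebyshev recurrence, one vanishing just before the first row and the other
    just after the last.  Writing W_n for U_(n-1), so that W_0 = 0 and W_1 = 1,
    and c = 4(x - 1), the entries of A are c W_a W_b / W_(m+1) with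
    a = min(i, j) and b = m + 1 - max(i, j) (indices from 1), minus 1 on the
    diagonal ([tridiag_mul_green], [CN_AE]).  Only diagonal entries can be
    negative, so row i has absolute sum rho(i, m + 1 - i) / W_(m+1), where
      rho(p, q) = c (S_p W_q + W_p S_q) + |c W_p W_q - W_(p+q)|
    and S_n = W_0 + ... + W_(n-1).

    The maximum is attained in a middle row ([norm_infty_CN_A]).  Let delta be
    the argument of the absolute value.  Summing the recurrence gives
    rho = sigma - delta + |delta| = max(sigma, sigma - 2 delta) with
    sigma = W_(p+q) - 2 (W_p + W_q), by [sum_lucas_mul].  Moving one step
    towards the middle, from (p, q) to (p+1, q-1), raises W_p W_q by exactly
    W_(q-p-1) ([lucas_exchange]) and lowers W_p + W_q by at least c W_(q-p-1)
    ([lucas_spread_ge]).  So sigma gains at least twice what delta gains, and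
    neither sigma nor sigma - 2 delta decreases.

    It remains to expand rho in the middle row.  The addition formula
    [lucas_add] linearizes the products W_a W_b into sums of W_n
    ([lucas_mul_sum], [lucas_mul_add_sum]); since C_n = c W_n and
    P_n = C_n - U_n, the diagonal term becomes the expression in absolute value
    and the off-diagonal terms become the double sums. *)

(** * The shifted Chebyshev sequence *)

(** The Lucas sequence with parameters 2x and 1, that is U_(n-1)(x): the shift
    makes the value at 0 vanish, so that the boundary rows of the tridiagonal
    matrices obey the same recurrence as the interior ones. *)
Definition lucas {R : comNzRingType} (x : R) (n : nat) : R :=
  (cheb_rec 0 1 n).[x].

Definition sum_lucas {R : comNzRingType} (x : R) (n : nat) : R :=
  \sum_(0 <= l < n) lucas x l.

Lemma cheb_rec_hornerSS {R : comNzRingType} (Q0 Q1 : {poly R}) (x : R) n :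
  (cheb_rec Q0 Q1 n.+2).[x]
  = 2 * x * (cheb_rec Q0 Q1 n.+1).[x] - (cheb_rec Q0 Q1 n).[x].
Proof. by rewrite [cheb_rec _ _ n.+2]/= !hornerE. Qed.

Lemma cheb_rec_hornerE {R : comNzRingType} (Q0 Q1 : {poly R}) (x : R)
    (f : nat -> R) :
  f 0 = Q0.[x] -> f 1 = Q1.[x] ->
  (forall n, f n.+2 = 2 * x * f n.+1 - f n) ->
  forall n, (cheb_rec Q0 Q1 n).[x] = f n.
Proof.
move=> f0 f1 fSS n.
suff [] : (cheb_rec Q0 Q1 n).[x] = f n /\
          (cheb_rec Q0 Q1 n.+1).[x] = f n.+1 by [].
elim: n => [|n [IH0 IH1]]; first by split.
by split=> //; rewrite cheb_rec_hornerSS IH0 IH1 fSS.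
Qed.

Section Identities.
Context {R : comNzRingType} (x : R).
Local Notation W := (lucas x).
Local Notation S := (sum_lucas x).

Lemma lucas0 : W 0 = 0. Proof. by rewrite /lucas /= horner0. Qed.
Lemma lucas1 : W 1 = 1. Proof. by rewrite /lucas /= !hornerE. Qed.
Lemma lucasSS n : W n.+2 = 2 * x * W n.+1 - W n.
Proof. exact: cheb_rec_hornerSS. Qed.

Lemma chebU_lucas n : (chebU R n).[x] = W n.+1.
Proof.
apply: (cheb_rec_hornerE _ _ _ (fun n => W n.+1)) => [||k].
- by rewrite lucas1 !hornerE.
- by rewrite lucasSS lucas1 lucas0 !hornerE subr0.
- exact: lucasSS.
Qed.

Lemma chebC_lucas n : (chebC R n).[x] = 4 * (x - 1) * W n.
Proof.
apply: (cheb_rec_hornerE _ _ _ (fun n => 4 * (x - 1) * W n)) => [||k].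
- by rewrite lucas0 horner0 mulr0.
- by rewrite lucas1 !hornerE.
- by rewrite lucasSS; ring.
Qed.

Lemma chebP_lucas n : (chebP R n).[x] = 4 * (x - 1) * W n - W n.+1.
Proof.
apply: (cheb_rec_hornerE _ _ _ (fun n => 4 * (x - 1) * W n - W n.+1)) => [||k].
- by rewrite lucas0 lucas1 !hornerE.
- by rewrite lucasSS lucas0 lucas1 !hornerE; ring.
- by rewrite !lucasSS; ring.
Qed.

(** The analogue of the addition formula for sinh: for x = cosh t, W n is
    sinh (n t) / sinh t. *)
Lemma lucas_add p q : W (p + q).+1 = W p.+1 * W q.+1 - W p * W q.
Proof.
elim: p q => [|p IH] q; first by rewrite lucas0 lucas1 mul0r subr0 mul1r.
by rewrite addSnnS IH !lucasSS; ring.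
Qed.

(** By how much W p * W q grows when p < q move one step towards each other.  The
    increment is the Casoratian of two solutions of the recurrence, n |-> W n and
    n |-> W (n + d), hence independent of p. *)
Lemma lucas_exchange p d : W p.+1 * W (p + d) - W p * W (p + d).+1 = W d.
Proof.
elim: p => [|p IH]; first by rewrite lucas0 lucas1 mul0r subr0 mul1r.
by rewrite -[RHS]IH addSn !lucasSS; ring.
Qed.

(** Linearization of products: each step of the induction is one instance of the
    addition formula. *)
Lemma lucas_mul_sum a d : W a * W (a + d) = \sum_(0 <= t < a) W (d + 1 + 2 * t).
Proof.
elim: a => [|a IH]; first by rewrite lucas0 mul0r big_nil.
rewrite big_nat_recr //= -IH.
have -> : (d + 1 + 2 * a = (a + (a + d)).+1)%N by lia.
by rewrite lucas_add addSn; ring.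
Qed.

(** The two expansions given by [lucas_mul_sum] run over indices of opposite
    parities and interleave into a single interval. *)
Lemma lucas_mul_add_sum a d :
  W a * (W (a + d) + W (a + d).+1) = \sum_(d.+1 <= n < d.+1 + 2 * a) W n.
Proof.
elim: a => [|a IH]; first by rewrite lucas0 mul0r muln0 addn0 big_geq.
have -> : (d.+1 + 2 * a.+1 = (d.+1 + 2 * a).+2)%N by lia.
rewrite 2?big_nat_recr; try lia.
rewrite -IH.
have -> : (d.+1 + 2 * a = (a + (a + d)).+1)%N by lia.
have -> : ((a + (a + d)).+2 = (a + (a + d).+1).+1)%N by lia.
by rewrite (lucas_add a (a + d)) (lucas_add a (a + d).+1) !addSn /=; ring.
Qed.

(** Telescoping: 2 (x - 1) W n is the second difference of W at n. *)
Lemma sum_lucasE n : 4 * (x - 1) * S n.+1 = 2 * (W n.+1 - W n - 1).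
Proof.
elim: n => [|n IH]; rewrite /sum_lucas big_nat_recr //=.
  by rewrite big_nil lucas0 lucas1; ring.
by rewrite mulrDr IH lucasSS; ring.
Qed.

(** Up to the factor W (p + q), this evaluates the signed row sums of the
    iteration matrix: the two sums are the off-diagonal part and the product is
    the diagonal part, before 1 is subtracted. *)
Lemma sum_lucas_mul p q :
  4 * (x - 1) * (S p * W q + W p * S q) + 4 * (x - 1) * (W p * W q)
  = 2 * (W (p + q) - W p - W q).
Proof.
case: p => [|p]; first by rewrite lucas0 /sum_lucas big_nil add0n; ring.
case: q => [|q]; first by rewrite lucas0 /sum_lucas big_nil addn0; ring.
have -> : (p.+1 + q.+1 = (p.+1 + q).+1)%N by lia.
rewrite lucas_add lucasSS.
have -> : 4 * (x - 1) * (S p.+1 * W q.+1 + W p.+1 * S q.+1)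
  = (4 * (x - 1) * S p.+1) * W q.+1 + W p.+1 * (4 * (x - 1) * S q.+1) by ring.
by rewrite !sum_lucasE; ring.
Qed.

(** Extending f by zero at both ends makes the first and last rows of the matrix
    act like the interior ones. *)
Lemma tridiag_row_sum m (a b : R) (f : nat -> R) (i : 'I_m) :
  f 0%N = 0 -> f m.+1 = 0 ->
  \sum_(l < m) tridiag_mx m a b i l * f l.+1 = a * f i.+1 + b * (f i + f i.+2).
Proof.
move=> f0 fm.
(* The entries of row i select the indices i.-1, i and i.+1 of the sum. *)
have Ed k : \sum_(l < m | l == k :> nat) f l.+1
            = if (k < m)%N then f k.+1 else 0.
  by rewrite -(big_mkord (fun l => l == k) (fun l => f l.+1)) big_nat1_eq.
have Eu : \sum_(l < m | l.+1 == i :> nat) f l.+1 = f i.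
  case: (i : nat) (ltn_ord i) => [|k] lt_m; first by rewrite big_pred0.
  by rewrite (Ed k) ltnW.
rewrite (eq_bigr (fun l : 'I_m =>
   a * (if l == i :> nat then f l.+1 else 0)
   + b * ((if l.+1 == i :> nat then f l.+1 else 0)
          + (if l == i.+1 :> nat then f l.+1 else 0)))); last first.
  move=> l _; rewrite mxE -val_eqE /=.
  have -> : (i == l :> nat) = (l == i :> nat) by lia.
  have -> : (i.+1 == l :> nat) = (l == i.+1 :> nat) by lia.
  case: (eqVneq (l : nat) i) => [e|n1].
    have -> : (l.+1 == i :> nat) = false by lia.
    have -> : (l == i.+1 :> nat) = false by lia.
    by ring.
  case: (eqVneq (l : nat) i.+1) => [e|n2] /=.
    have -> : (l.+1 == i :> nat) = false by lia.
    by ring.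
  by case: ifP => _; ring.
rewrite big_split /= -!mulr_sumr big_split /= -!big_mkcond /= Eu !Ed ltn_ord.
case: ltnP => // le_m; have -> : i.+2 = m.+1 by have := ltn_ord i; lia.
by rewrite fm.
Qed.

End Identities.

(** * Monotonicity of the row norms towards the middle *)

(** The absolute row sum of the iteration matrix, times W (p + q), for the row
    with p - 1 entries to the left of the diagonal and q - 1 to its right. *)
Definition scaled_row_norm {R : realFieldType} (x : R) (p q : nat) : R :=
  4 * (x - 1) * (sum_lucas x p * lucas x q + lucas x p * sum_lucas x q)
  + `|4 * (x - 1) * (lucas x p * lucas x q) - lucas x (p + q)|.

Section Monotonicity.
Context {R : realFieldType} (x : R) (hx : 1 <= x).
Local Notation W := (lucas x).
Local Notation S := (sum_lucas x).

Let x1 : 0 <= x - 1. Proof. by rewrite subr_ge0. Qed.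

Lemma lucas_ge0_le n : 0 <= W n <= W n.+1.
Proof.
elim: n => [|n /andP[IH0 IH1]]; first by rewrite lucas0 lucas1 lexx ler01.
have le01 := le_trans IH0 IH1; rewrite le01 /= lucasSS.
by have := mulr_ge0 (x1 : 0 <= x - 1) le01; lra.
Qed.

Lemma lucas_ge0 n : 0 <= W n. Proof. by case/andP: (lucas_ge0_le n). Qed.

Lemma lucas_le m n : (m <= n)%N -> W m <= W n.
Proof.
move=> /subnKC <-; elim: (n - m)%N => [|k IH]; first by rewrite addn0.
by rewrite addnS (le_trans IH) //; case/andP: (lucas_ge0_le (m + k)).
Qed.

Lemma lucas_gt0 n : 0 < W n.+1.
Proof. by apply: (lt_le_trans ltr01); rewrite -(lucas1 x) lucas_le. Qed.

(** The right-hand side is 2 (x - 1) times the sum of W over the d indices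
    strictly between p and p + d + 1, so it suffices to bound that sum below by
    2 W d.  For d at least 2 the two largest terms suffice, since p > 0; for
    d = 1 the single term is at least W 2 = 2 x, which is at least 2 W 1.
    The induction adds two terms at a time to expose the two largest. *)
Lemma lucas_spread_ge p d : (0 < p)%N ->
  4 * (x - 1) * W d <= W p + W (p + d.+1) - W p.+1 - W (p + d).
Proof.
move=> p_gt0.
suff [] : 4 * (x - 1) * W d <= W p + W (p + d.+1) - W p.+1 - W (p + d) /\
   4 * (x - 1) * W d.+1 <= W p + W (p + d.+2) - W p.+1 - W (p + d.+1) by [].
elim: d => [|d [IH0 IH1]].
  rewrite !addnS addn0 lucas0 lucas1 lucasSS.
  have : W 2 <= W p.+1 by rewrite lucas_le.
  rewrite -subr_ge0 lucasSS lucas1 lucas0 => /(mulr_ge0 x1) h.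
  by have := mulr_ge0 x1 x1; split; lra.
split=> //; rewrite !addnS in IH0 IH1 *.
have h1 : W d.+2 <= W (p + d).+2 by rewrite lucas_le //; lia.
have h2 : W d.+2 <= W (p + d).+1 by rewrite lucas_le //; lia.
have Wd := lucas_ge0 d.
have := mulr_ge0 x1 Wd.
rewrite -subr_ge0 in h1; have := mulr_ge0 x1 h1.
rewrite -subr_ge0 in h2; have := mulr_ge0 x1 h2.
have e1 := lucasSS x (p + d).
have e2 := lucasSS x (p + d).+1.
by rewrite e2 in IH1 *; lra.
Qed.

(** Writing the norm as max (sigma, sigma - 2 delta), with delta the signed
    diagonal entry and sigma the signed row sum: both branches grow, the second
    because sigma gains at least twice what delta gains. *)
Lemma scaled_row_norm_le p d : (0 < p)%N ->
  scaled_row_norm x p (p + d.+2) <= scaled_row_norm x p.+1 (p + d.+1).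
Proof.
move=> p_gt0; rewrite /scaled_row_norm.
have eN : (p + (p + d.+2) = p.+1 + (p + d.+1))%N by lia.
rewrite eN.
have e1 := sum_lucas_mul x p (p + d.+2).
have e2 := sum_lucas_mul x p.+1 (p + d.+1).
have ex := lucas_exchange x p d.+1.
have sp := lucas_spread_ge p d.+1 p_gt0.
have Wd := lucas_ge0 d.+1.
rewrite eN in e1; rewrite -addnS in ex.
set N := W (p.+1 + (p + d.+1)) in e1 e2 *.
set a := W p in e1 ex sp *; set b := W (p + d.+2) in e1 ex sp *.
set a' := W p.+1 in e2 ex sp *; set b' := W (p + d.+1) in e2 ex sp *.
set c := 4 * (x - 1) in e1 e2 sp *.
have c0 : 0 <= c by rewrite mulr_ge0.
have cW : 0 <= c * W d.+1 by rewrite mulr_ge0.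
have cex : c * (a' * b') - c * (a * b) = c * W d.+1 by rewrite -ex; ring.
case: (ger0P (c * (a * b) - N));
  case: (ger0P (c * (a' * b') - N)) => h1 h2; lra.
Qed.

Lemma scaled_row_norm_le_mid b e p : (0 < p)%N ->
  scaled_row_norm x p (p + (2 * e + b))
  <= scaled_row_norm x (p + e) (p + e + b).
Proof.
elim: e p => [|e IH] p p_gt0; first by rewrite !addn0 add0n.
have -> : (p + (2 * e.+1 + b) = p + (2 * e + b).+2)%N by lia.
apply: (le_trans (scaled_row_norm_le _ _ p_gt0)).
have -> : (p + (2 * e + b).+1 = p.+1 + (2 * e + b))%N by lia.
by rewrite (le_trans (IH _ _)) // addSnnS.
Qed.

Lemma scaled_row_normC p q : scaled_row_norm x p q = scaled_row_norm x q p.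
Proof.
rewrite /scaled_row_norm (addnC q p).
by rewrite (mulrC (W q) (W p)); congr (_ + _); ring.
Qed.

End Monotonicity.

(** * The entries and row norms of the iteration matrix *)
Section IterationMatrix.
Context {R : realFieldType} (x : R) (hx : 1 <= x) (m : nat).
Local Notation W := (lucas x).
Local Notation S := (sum_lucas x).

Definition green_mx : 'M[R]_m :=
  \matrix_(i, j) (W (minn i j).+1 * W (m - maxn i j) / W m.+1).

(** As functions of i, the entries of column j follow a solution of the
    recurrence that vanishes before the first row up to the diagonal, and one that
    vanishes after the last row from the diagonal on.  Hence only the diagonal
    entry of the product survives, and it is 1 by the addition formula. *)
Lemma tridiag_mul_green : tridiag_mx m (2 * x) (- 1) *m green_mx = 1%:M.
Proof.
have Wm : W m.+1 != 0 by rewrite gt_eqF ?lucas_gt0.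
apply/matrixP => i j; rewrite !mxE.
pose f l := W (minn l j.+1) * W (m.+1 - maxn l j.+1) / W m.+1.
have ltj := ltn_ord j; have lti := ltn_ord i.
rewrite (eq_bigr (fun l : 'I_m => tridiag_mx m (2 * x) (- 1) i l * f l.+1)).
  2: by move=> l _; rewrite [green_mx _ _]mxE /f minnSS maxnSS subSS.
rewrite tridiag_row_sum; first last.
- rewrite /f; have -> : (m.+1 - maxn m.+1 j.+1 = 0)%N by lia.
  by rewrite lucas0 mulr0 mul0r.
- by rewrite /f min0n lucas0 !mul0r.
rewrite /f -val_eqE /=; case: (ltngtP i j) => [lt_ij|lt_ji|e_ij].
- have -> : (minn i j.+1 = i)%N by lia.
  have -> : (minn i.+1 j.+1 = i.+1)%N by lia.
  have -> : (minn i.+2 j.+1 = i.+2)%N by lia.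
  have -> : (maxn i j.+1 = j.+1)%N by lia.
  have -> : (maxn i.+1 j.+1 = j.+1)%N by lia.
  have -> : (maxn i.+2 j.+1 = j.+1)%N by lia.
  by rewrite lucasSS mulr0n; ring.
- have -> : (minn i j.+1 = j.+1)%N by lia.
  have -> : (minn i.+1 j.+1 = j.+1)%N by lia.
  have -> : (minn i.+2 j.+1 = j.+1)%N by lia.
  have -> : (maxn i j.+1 = i)%N by lia.
  have -> : (maxn i.+1 j.+1 = i.+1)%N by lia.
  have -> : (maxn i.+2 j.+1 = i.+2)%N by lia.
  have -> : (m.+1 - i = (m.+1 - i.+2).+2)%N by lia.
  have -> : (m.+1 - i.+1 = (m.+1 - i.+2).+1)%N by lia.
  by rewrite lucasSS mulr0n; ring.
- rewrite -e_ij minnn maxnn.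
  have -> : (minn i i.+1 = i)%N by lia.
  have -> : (minn i.+2 i.+1 = i.+1)%N by lia.
  have -> : (maxn i i.+1 = i.+1)%N by lia.
  have -> : (maxn i.+2 i.+1 = i.+2)%N by lia.
  have eWm : W m.+1 = W i.+2 * W (m.+1 - i.+1) - W i.+1 * W (m.+1 - i.+2).
    have -> : (m.+1 - i.+1 = (m.+1 - i.+2).+1)%N by lia.
    by rewrite -lucas_add; congr W; lia.
  have -> : true%:R = (W i.+2 * W (m.+1 - i.+1) - W i.+1 * W (m.+1 - i.+2))
                      / W m.+1 by rewrite -eWm divff.
  by rewrite lucasSS; ring.
Qed.

(** CN_N is 2 - CN_M and CN_M is (s / 2) times the tridiagonal matrix inverted
    above, so that CN_A is 2 CN_M^-1 - 1. *)
Lemma CN_AE (s : R) : 0 < s -> x = 1 + 1 / s ->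
  CN_A m s = (4 * (x - 1)) *: green_mx - 1%:M.
Proof.
move=> s_gt0 xE; have s0 : s != 0 by rewrite gt_eqF.
have MG : CN_M m s *m ((2 / s) *: green_mx) = 1%:M.
  have -> : CN_M m s = (s / 2) *: tridiag_mx m (2 * x) (- 1).
    apply/matrixP => i j; rewrite !mxE xE; case: ifP => _; first by field.
    by case: ifP => _; field.
  rewrite -scalemxAl -scalemxAr scalerA tridiag_mul_green.
  by have -> : s / 2 * (2 / s) = 1 by [field]; rewrite scale1r.
have NE : CN_N m s = 2%:M - CN_M m s.
  apply/matrixP => i j; rewrite !mxE; case: eqP => _ /=.
    by rewrite mulr1n; ring.
  by case: ifP => _; rewrite mulr0n; ring.
have [Mu _] := mulmx1_unit MG.
have -> : CN_A m s = invmx (CN_M m s) *m 2%:M - 1%:M.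
  by rewrite /CN_A NE mulmxBr mulVmx.
have -> : invmx (CN_M m s) = (2 / s) *: green_mx.
  by rewrite -[LHS]mulmx1 -MG mulKmx.
rewrite mul_mx_scalar scalerA; congr (_ *: _ - _).
by rewrite xE; field.
Qed.

(** The entries of the Green function are nonnegative, so the absolute value
    matters on the diagonal only. *)
Lemma CN_A_row_norm (s : R) (i : 'I_m) : 0 < s -> x = 1 + 1 / s ->
  \sum_(j < m) `|CN_A m s i j| = scaled_row_norm x i.+1 (m - i) / W m.+1.
Proof.
move=> s_gt0 xE; have Wm := lucas_gt0 x hx m; have lti := ltn_ord i.
set c := 4 * (x - 1); have c0 : 0 <= c by rewrite mulr_ge0 ?subr_ge0.
pose g (j : nat) := c * (W (minn i j).+1 * W (m - maxn i j) / W m.+1).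
have g_ge0 j : 0 <= g j.
  by rewrite mulr_ge0 // divr_ge0 ?(ltW Wm) // mulr_ge0 // lucas_ge0.
rewrite (eq_bigr (fun j : 'I_m => `|g j - (i == j :> nat)%:R|)); last first.
  by move=> j _; rewrite (CN_AE _ s_gt0 xE) !mxE -val_eqE.
rewrite -(big_mkord predT (fun j => `|g j - (i == j :> nat)%:R|)).
(* Entries left of the diagonal, the diagonal one, entries to its right. *)
rewrite (big_cat_nat (n := i)) //=; last exact: ltnW.
rewrite [X in _ + X]big_ltn // eqxx.
have -> : \sum_(0 <= j < i) `|g j - (i == j :> nat)%:R|
          = c * (S i.+1 * W (m - i)) / W m.+1.
  rewrite /sum_lucas big_nat_recl // lucas0 add0r mulr_suml mulr_sumr mulr_suml.
  apply: eq_big_nat => j /andP[_ lt_ji].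
  rewrite (gtn_eqF lt_ji) subr0 ger0_norm // /g.
  have -> : (minn i j = j)%N by lia.
  have -> : (maxn i j = i)%N by lia.
  by rewrite !mulrA.
have -> : \sum_(i.+1 <= j < m) `|g j - (i == j :> nat)%:R|
          = c * (W i.+1 * S (m - i)) / W m.+1.
  have -> : (m - i = (m - i.+1).+1)%N by lia.
  rewrite /sum_lucas big_nat_recl // lucas0 add0r [in RHS]big_nat_rev /= add0n.
  rewrite [LHS](@big_addn _ _ _ 0 m i.+1) mulr_sumr mulr_sumr mulr_suml.
  apply: eq_big_nat => j /andP[_ lt_jm].
  have /ltn_eqF -> : (i < j + i.+1)%N by lia.
  rewrite subr0 ger0_norm // /g.
  have -> : (minn i (j + i.+1) = i)%N by lia.
  have -> : (m - maxn i (j + i.+1) = (m - i.+1 - j.+1).+1)%N by lia.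
  by rewrite !mulrA.
rewrite /g minnn maxnn /scaled_row_norm -/c.
have -> : (i.+1 + (m - i) = m.+1)%N by lia.
rewrite [RHS]mulrDl -[in RHS](gtr0_norm Wm) -normf_div (gtr0_norm Wm).
rewrite mulrBl divff ?gt_eqF // !mulrA mulrDr mulrDl !mulrA.
by rewrite addrA addrAC.
Qed.

(** The row with p = i + 1 and p + b = m - i is the middle one, b being 0 or 1
    according to the parity of m + 1.  Rows below the middle are reflected to
    rows above it by symmetry of the norm in p and q. *)
Lemma norm_infty_CN_A (s : R) p b : 0 < s -> x = 1 + 1 / s ->
  (0 < p)%N -> (b <= 1)%N -> (2 * p + b = m.+1)%N ->
  norm_infty (CN_A m s) = scaled_row_norm x p (p + b) / W m.+1.
Proof.
move=> s_gt0 xE p_gt0 b_le1 eN; have Wm := lucas_gt0 x hx m.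
have lt_pm : (p.-1 < m)%N by lia.
have row_mid : \sum_(j < m) `|CN_A m s (Ordinal lt_pm) j|
               = scaled_row_norm x p (p + b) / W m.+1.
  rewrite (CN_A_row_norm _ _ s_gt0 xE) /=.
  by congr (scaled_row_norm _ _ _ / _); lia.
apply/le_anti/andP; split; last first.
  by apply: (bigmax_sup (Ordinal lt_pm)) => //; rewrite row_mid.
apply: bigmax_le => [|i _]; first by rewrite -row_mid sumr_ge0.
have lti := ltn_ord i.
rewrite (CN_A_row_norm _ _ s_gt0 xE) ler_pM2r ?invr_gt0 //.
have [le_ip|lt_pi] := leqP i.+1 p.
  have := scaled_row_norm_le_mid x hx b (p - i.+1) i.+1 isT.
  by congr (scaled_row_norm _ _ _ <= scaled_row_norm _ _ _); lia.
rewrite scaled_row_normC.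
have mi : (0 < m - i)%N by lia.
have := scaled_row_norm_le_mid x hx b (i.+1 - (p + b)) (m - i) mi.
by congr (scaled_row_norm _ _ _ <= scaled_row_norm _ _ _); lia.
Qed.

End IterationMatrix.

(** * Expansion of the middle row in the polynomials C and P *)
Section MiddleRow.
Context {R : comNzRingType} (x : R).
Local Notation W := (lucas x).
Local Notation S := (sum_lucas x).
Local Notation C n := (chebC R n).[x].
Local Notation P n := (chebP R n).[x].

Lemma sum_chebC (r : seq nat) (f : nat -> nat) :
  \sum_(n <- r) C (f n) = 4 * (x - 1) * \sum_(n <- r) W (f n).
Proof. by rewrite mulr_sumr; apply: eq_bigr => n _; rewrite chebC_lucas. Qed.

(** Since P = C - U, the term P (2k + 1) contributes both the last term of the
    expansion of the square of W (k + 1) and the subtracted W (2k + 2).  The even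
    case is the same. *)
Lemma diag_odd k :
  P (2 * k + 1)%N + \sum_(1 <= n < k.+1) C (2 * n - 1)%N
  = 4 * (x - 1) * (W k.+1 * W k.+1) - W (k.+1 + k.+1).
Proof.
have := lucas_mul_sum x k.+1 0; rewrite addn0 => ->.
rewrite sum_chebC chebP_lucas [in RHS]big_nat_recr //=.
rewrite big_add1 /=.
have -> : \sum_(0 <= n < k) W (2 * n.+1 - 1)
        = \sum_(0 <= n < k) W (0 + 1 + 2 * n).
  by apply: eq_bigr => n _; congr W; lia.
have -> : (0 + 1 + 2 * k = 2 * k + 1)%N by lia.
have -> : (k.+1 + k.+1 = (2 * k + 1).+1)%N by lia.
by ring.
Qed.

Lemma diag_even k : (0 < k)%N ->
  P (2 * k)%N + \sum_(1 <= n < (k - 1).+1) C (2 * n)%N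
  = 4 * (x - 1) * (W k * W (k + 1)) - W (k + (k + 1)).
Proof.
case: k => // k _.
rewrite sum_chebC chebP_lucas lucas_mul_sum [in RHS]big_nat_recr //=.
rewrite subn1 big_add1 /=.
have -> : \sum_(0 <= n < k) W (2 * n.+1) = \sum_(0 <= n < k) W (1 + 1 + 2 * n).
  by apply: eq_bigr => n _; congr W; lia.
have -> : (1 + 1 + 2 * k = 2 * k.+1)%N by lia.
have -> : (k.+1 + (k.+1 + 1) = (2 * k.+1).+1)%N by lia.
by ring.
Qed.

(** The inner sum of index i is the expansion of W (k - i) * W (k + 1); by symmetry
    the middle row consists of two copies of these products. *)
Lemma offdiag_odd k :
  \sum_(0 <= i < k) \sum_(1 <= n < (k - i).+1) C (2 * n + i)%N
  = 4 * (x - 1) * (S k.+1 * W k.+1).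
Proof.
rewrite /sum_lucas big_nat_recl // lucas0 add0r mulr_suml mulr_sumr
  [RHS]big_nat_rev /=.
apply: eq_big_nat => i /andP[_ lt_ik]; rewrite sum_chebC big_add1 /=.
have -> : ((0 + k - i.+1).+1 = k - i)%N by lia.
have -> : (k.+1 = k - i + i.+1)%N by lia.
rewrite lucas_mul_sum; congr (_ * _).
by apply: eq_bigr => n _; congr W; lia.
Qed.

(** The off-diagonal part of the even case is not symmetric: splitting off
    W k * W k, the rest pairs the consecutive factors W k and W (k + 1), whose
    products with W (k - i) merge into one interval of indices. *)
Lemma offdiag_even k : (0 < k)%N ->
  \sum_(1 <= i < (k - 1).+1) \sum_(1 + i <= n < (2 * k - i).+1) C n
   + \sum_(1 <= n < k.+1) C (2 * n - 1)%N
  = 4 * (x - 1) * (S k * W (k + 1) + W k * S (k + 1)).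
Proof.
case: k => // k _; rewrite addn1 subn1 /=.
have -> : S k.+2 = S k.+1 + W k.+1 by rewrite /sum_lucas big_nat_recr.
have -> : S k.+1 * W k.+2 + W k.+1 * (S k.+1 + W k.+1)
          = S k.+1 * (W k.+1 + W k.+2) + W k.+1 * W k.+1 by ring.
rewrite mulrDr; congr (_ + _); last first.
  have := lucas_mul_sum x k.+1 0; rewrite addn0 => ->.
  rewrite sum_chebC big_add1 /=; congr (_ * _).
  by apply: eq_bigr => n _; congr W; lia.
rewrite /sum_lucas [in RHS]big_nat_recl // lucas0 add0r mulr_suml mulr_sumr
  [RHS]big_nat_rev /=.
rewrite big_add1 /=; apply: eq_big_nat => i /andP[_ lt_ik].
have -> : ((0 + k - i.+1).+1 = k - i)%N by lia.
have -> : (k.+2 = (k - i + i.+1).+1)%N by lia.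
have -> : (k.+1 = k - i + i.+1)%N by lia.
rewrite lucas_mul_add_sum (sum_chebC _ id); congr (_ * _).
by congr bigop; congr index_iota; lia.
Qed.

End MiddleRow.

Theorem lemma5 (R : realFieldType) (s : R) (hs : 0 < s) :
  let x := 1 + 1 / s in
  let U := fun n : nat => (chebU R n).[x] in
  let P := fun n : nat => (chebP R n).[x] in
  let C := fun n : nat => (chebC R n).[x] in
  (forall m : nat, (3 <= m)%N -> odd m ->
     norm_infty (CN_A m s) =
       1 / U m *
       (`|P m + \sum_(1 <= n < ((m - 1) %/ 2).+1) C (2 * n - 1)%N|
        + 2 * \sum_(0 <= i < ((m - 3) %/ 2).+1)
                \sum_(1 <= n < ((m - (2 * i + 1)) %/ 2).+1) C (2 * n + i)%N))
  /\
  (forall m : nat, (2 <= m)%N -> ~~ odd m ->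
     norm_infty (CN_A m s) =
       1 / U m *
       (`|P m + \sum_(1 <= n < (m %/ 2 - 1).+1) C (2 * n)%N|
        + \sum_(1 <= i < (m %/ 2 - 1).+1)
            \sum_(1 + i <= n < (m - i).+1) C n
        + \sum_(1 <= n < (m %/ 2).+1) C (2 * n - 1)%N)).
Proof.
move=> x U P C.
have hx : 1 <= x by rewrite /x lerDl divr_ge0 // ltW.
split=> m m_ge m_odd.
- have [k mE] : exists k, m = (2 * k + 1)%N by exists m./2; lia.
  rewrite (norm_infty_CN_A x hx m s k.+1 0 hs) //; try lia.
  have -> : ((m - 1) %/ 2 = k)%N by lia.
  have -> : (((m - 3) %/ 2).+1 = k)%N by lia.
  have -> : \sum_(0 <= i < k) \sum_(1 <= n < ((m - (2 * i + 1)) %/ 2).+1)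
              C (2 * n + i)%N
          = \sum_(0 <= i < k) \sum_(1 <= n < (k - i).+1) C (2 * n + i)%N.
    by apply: eq_bigr => i _; congr bigop; congr index_iota; lia.
  rewrite offdiag_odd [in P m]mE diag_odd /scaled_row_norm /U chebU_lucas addn0.
  by field; rewrite gt_eqF ?lucas_gt0.
- have [k mE] : exists k, m = (2 * k)%N by exists m./2; lia.
  have k_gt0 : (0 < k)%N by lia.
  rewrite (norm_infty_CN_A x hx m s k 1 hs) //; try lia.
  have -> : (m %/ 2 = k)%N by lia.
  rewrite -addrA mE.
  rewrite offdiag_even // diag_even // /scaled_row_norm /U chebU_lucas.
  by field; rewrite gt_eqF ?lucas_gt0.
Qed.
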